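(* Let $d \ge 2$ and let $g : \mathbb{R}^d \to \mathbb{R}^d$ be continuous and linearly homogeneous with $g(\mathbf{x}) = \mathbf{0}$ only for $\mathbf{x} = \mathbf{0}$. Let $G : \mathbb{S}^{d-1} \to \mathbb{S}^{d-1}$ be given by $G(\mathbf{z}) = g(\mathbf{z})/\|g(\mathbf{z})\|$. (i) If $\lambda(\mu) < 0$ for every ergodic invariant probability measure $\mu$ of $G$, then $\mathbf{0}$ is an asymptotically stable fixed point of $g$. (ii) If $\mathbf{0}$ is a Lyapunov stable fixed point of $g$, then $\lambda(\mu) \le 0$ for every ergodic invariant probability measure $\mu$ of $G$.
   Context: $\mathbf{0}$ is the origin of $\mathbb{R}^d$, $\|\cdot\|$ is the Euclidean norm, $B_r = \{\mathbf{x} \in \mathbb{R}^d : \|\mathbf{x}\| < r\}$, $\mathbb{S}^{d-1} = \{\mathbf{x} \in \mathbb{R}^d : \|\mathbf{x}\| = 1\}$, and superscripts on maps denote iterates. A map $g : \mathbb{R}^d \to \mathbb{R}^d$ is linearly homogeneous if $g(\alpha \mathbf{x}) = \alpha g(\mathbf{x})$ for all $\mathbf{x} \in \mathbb{R}^d$ and all real $\alpha \ge 0$. (In particular $g(\mathbf{0}) = \mathbf{0}$.) Define $D : \mathbb{S}^{d-1} \to (0,\infty)$ by $D(\mathbf{z}) = \|g(\mathbf{z})\|$; both $D$ and $G$ are well-defined and continuous. For any invariant (Borel) probability measure $\mu$ of $G$, define $\lambda(\mu) = \int_{\mathbb{S}^{d-1}} \ln(D)\, d\mu$. Let $F : \mathbb{R}^d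 \to \mathbb{R}^d$ be continuous with $F(\mathbf{0}) = \mathbf{0}$. The fixed point $\mathbf{0}$ is Lyapunov stable if for all $\varepsilon > 0$ there exists $\delta > 0$ such that $F^n(\mathbf{x}) \in B_\varepsilon$ for all $\mathbf{x} \in B_\delta$ and all $n \ge 0$. It is asymptotically stable if it is Lyapunov stable and there exists $\delta > 0$ such that $F^n(\mathbf{x}) \to \mathbf{0}$ as $n \to \infty$ for all $\mathbf{x} \in B_\delta$. *)

(* Defs.v *)
From HB Require Import structures.
From mathcomp Require Import all_boot all_order all_algebra.
From mathcomp Require Import all_classical all_reals all_analysis.

Set Implicit Arguments.
Unset Strict Implicit.
Unset Printing Implicit Defensive.

Import Order.TTheory GRing.Theory Num.Theory.
Import numFieldNormedType.Exports.

Local Open Scope classical_set_scope.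
Local Open Scope ring_scope.

(* The norm `|x| that the library puts on 'rV[R]_d is the sup norm; its
   topology is the usual one, but balls and spheres need the Euclidean norm. *)
Definition enorm {R : realType} {d : nat} (x : 'rV[R]_d) : R :=
  Num.sqrt (\sum_(i < d) x 0 i ^+ 2).

Definition eball {R : realType} {d : nat} (r : R) : set 'rV[R]_d :=
  [set x | enorm x < r].

Definition usphere (R : realType) (d : nat) : set 'rV[R]_d :=
  [set x | enorm x = 1].
Arguments usphere : clear implicits.

Lemma enorm_eq0 {R : realType} {d : nat} (x : 'rV[R]_d) :
  enorm x = 0 -> x = 0.
Proof.
move=> /eqP; rewrite sqrtr_eq0 => x0.
have s0 : \sum_(i < d) x 0 i ^+ 2 = 0.
  by apply/le_anti; rewrite x0 sumr_ge0// => i _; exact: sqr_ge0.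
apply/rowP => i; rewrite mxE; apply/eqP; rewrite -sqrf_eq0; apply/eqP.
exact: (psumr_eq0P (fun j _ => sqr_ge0 (x 0 j)) s0).
Qed.

Lemma enormZ {R : realType} {d : nat} (a : R) (x : 'rV[R]_d) :
  enorm (a *: x) = `|a| * enorm x.
Proof.
rewrite /enorm -sqrtr_sqr -sqrtrM ?sqr_ge0// mulr_sumr; congr Num.sqrt.
by apply: eq_bigr => i _; rewrite mxE exprMn.
Qed.

Lemma usphere_delta (R : realType) (n : nat) :
  (delta_mx 0 0 : 'rV[R]_n.+1) \in usphere R n.+1.
Proof.
rewrite inE /usphere/= /enorm (bigD1 ord0)//= big1.
  by rewrite mxE !eqxx expr1n addr0 sqrtr1.
by move=> i /negPf i0; rewrite mxE eqxx i0 expr0n.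
Qed.

(* The unit sphere of R^(n+1) as a type. The dimension is a successor because
   measurable types are required to be inhabited. *)
Definition sphere (R : realType) (n : nat) : Type := usphere R n.+1.

HB.instance Definition _ (R : realType) (n : nat) :=
  PseudoMetric.copy (sphere R n) (set_type (usphere R n.+1)).
HB.instance Definition _ (R : realType) (n : nat) :=
  isPointed.Build (sphere R n)
    (exist (fun x => x \in usphere R n.+1) _ (usphere_delta R n)).

(* Borel sigma-algebra of the subspace topology. *)
HB.instance Definition _ (R : realType) (n : nat) :=
  Measurable.copy (sphere R n) (g_sigma_algebraType (@open (sphere R n))).

Definition linearly_homogeneous {R : realType} {d : nat}
    (g : 'rV[R]_d -> 'rV[R]_d) : Prop :=
  forall (a : R) (x : 'rV[R]_d), 0 <= a -> g (a *: x) = a *: g x.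

Lemma normalized_in_usphere {R : realType} {n : nat}
    (g : 'rV[R]_n.+1 -> 'rV[R]_n.+1) (g_eq0 : forall x, g x = 0 -> x = 0)
    (z : sphere R n) :
  (enorm (g (sval z)))^-1 *: g (sval z) \in usphere R n.+1.
Proof.
have z1 : enorm (sval z) = 1 by exact: set_mem (svalP z).
rewrite inE /usphere/= enormZ ger0_norm ?invr_ge0 ?sqrtr_ge0// mulVf//.
apply/eqP => /enorm_eq0/g_eq0 z0; move: z1.
rewrite z0 -(scale0r (0 : 'rV[R]_n.+1)) enormZ normr0 mul0r => /esym/eqP.
by rewrite oner_eq0.
Qed.

Definition sphere_map {R : realType} {n : nat}
    (g : 'rV[R]_n.+1 -> 'rV[R]_n.+1) (g_eq0 : forall x, g x = 0 -> x = 0)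
    (z : sphere R n) : sphere R n :=
  exist (fun x => x \in usphere R n.+1) ((enorm (g (sval z)))^-1 *: g (sval z))
    (normalized_in_usphere g_eq0 z).

Definition growth {R : realType} {n : nat}
    (g : 'rV[R]_n.+1 -> 'rV[R]_n.+1) (z : sphere R n) : R :=
  enorm (g (sval z)).

Definition invariant_measure {disp : measure_display}
    {T : measurableType disp} {R : realType} (f : T -> T)
    (mu : probability T R) : Prop :=
  forall A : set T, measurable A -> mu (f @^-1` A) = mu A.

Definition ergodic_measure {disp : measure_display}
    {T : measurableType disp} {R : realType} (f : T -> T)
    (mu : probability T R) : Prop :=
  forall A : set T, measurable A -> f @^-1` A = A ->
    mu A = 0%E \/ mu A = 1%E.

Definition lyapunov_exponent {R : realType} {n : nat}
    (g : 'rV[R]_n.+1 -> 'rV[R]_n.+1) (mu : probability (sphere R n) R) : R :=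
  \int[mu]_z ln (growth g z).

Definition lyapunov_stable {R : realType} {d : nat}
    (F : 'rV[R]_d -> 'rV[R]_d) : Prop :=
  forall e : R, 0 < e -> exists2 delta : R, 0 < delta &
    forall x, eball delta x -> forall k : nat, eball e (iter k F x).

Definition asymptotically_stable {R : realType} {d : nat}
    (F : 'rV[R]_d -> 'rV[R]_d) : Prop :=
  lyapunov_stable F /\
  exists2 delta : R, 0 < delta &
    forall x, eball delta x -> iter k F x @[k --> \oo] --> (0 : 'rV[R]_d).

(* Main.v *)
Require Import Defs.
From HB Require Import structures.
From mathcomp Require Import all_boot all_order all_algebra.
From mathcomp Require Import all_classical all_reals all_analysis.
From mathcomp Require Import measurable_realfun lra ring.

(** By homogeneity, [ln |g^k z|] is the Birkhoff sum of [phi z = ln |g z|] along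
    the orbit of [z] under the projected map [G] on the sphere, and the exponent
    of an invariant measure is the integral of [phi]. Stability bounds all the
    [|g^k z|] by a constant, so that [k] times the exponent is bounded above and
    the exponent is at most 0: this is (ii), [lyapunov_exponent_le0].

    For (i), suppose first that some continuous [h] makes
    [phi + h - h \o G] negative everywhere, hence at most [- e] for some
    [e > 0]. Then [|x| exp (- h (x / |x|))] is a strict Lyapunov function of [g],
    and the origin is exponentially stable ([exponentially_stable]). It remains
    to see that, if there is no such [h], some ergodic measure has a nonnegative
    exponent ([ergodic_maximizing_measure], valid for every continuous map [T]
    of a compact metric space). Let [p f] be the infimum of the [c] such that
    [f + h - h \o T <= c] for some continuous [h] ([max_average]); it is
    sublinear, and [p phi >= 0]. A linear functional below [p] is positive,
    normalized and [T]-invariant, that is, integration against an invariant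
    probability measure.

    The functional is chosen so as to be extreme. Take a sequence [v] dense in the
    continuous functions, preceded by [phi], and among the functionals below [p]
    maximize the value at [phi], then at [v 0], then at [v 1], and so on. Each
    step replaces a sublinear functional by a smaller one given by an explicit
    formula ([face]), and the limit ([exposed]) is linear because it is odd on a
    dense sequence: no choice of a linear extension is involved. The value at
    [phi] is [p phi >= 0], and two invariant functionals below [p] which average
    to the limit must both equal it ([exposed_extreme]).

    The functional is turned into a measure by the Riesz representation theorem
    ([riesz_probability], [riesz_representation]). If [A] is invariant of measure
    [a] strictly between 0 and 1, the normalized integrals over [A] and over its
    complement average to the functional, hence equal it: the integral of [f]
    over [A] is [a] times its whole integral. For an increasing sequence of
    functions of limit at least 1 on [A] and of integrals at most [c] this gives
    [a <= a * c]; as the infimum of such [c] is [a], this contradicts [a < 1]. *)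

Set Implicit Arguments.
Unset Strict Implicit.
Unset Printing Implicit Defensive.

Import Order.TTheory GRing.Theory Num.Theory.
Import numFieldNormedType.Exports.
Local Open Scope classical_set_scope.
Local Open Scope ring_scope.

(** * Lexicographic maximization below a sublinear functional *)

Section exposed_functional.
Context {R : realType} {V : zmodType}.
Variable C : set V.
Hypothesis C0 : C 0.
Hypothesis CB : forall u v, C u -> C v -> C (u - v).

Record sublinear_on (p : V -> R) : Prop := SublinearOn {
  sublinear0 : p 0 <= 0 ;
  sublinearD : forall u v, C u -> C v -> p (u + v) <= p u + p v ;
  sublinear_mulrn_ge : forall u k, C u -> p u *+ k <= p (u *+ k) }.

Definition additive_on (L : V -> R) : Prop :=
  forall u v, C u -> C v -> L (u + v) = L u + L v.

Let CN u : C u -> C (- u).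
Proof. by move=> Cu; rewrite -[- u]add0r; exact: CB. Qed.

Let CD u v : C u -> C v -> C (u + v).
Proof. by move=> Cu Cv; rewrite -[v]opprK; apply: CB => //; exact: CN. Qed.

Let CMn u k : C u -> C (u *+ k).
Proof.
move=> Cu; elim: k => [|k IH]; first by rewrite mulr0n.
by rewrite mulrS; exact: CD.
Qed.

Lemma additive_on0 L : additive_on L -> L 0 = 0.
Proof. by move=> LD; have := LD _ _ C0 C0; rewrite addr0; lra. Qed.

Lemma additive_onN L u : additive_on L -> C u -> L (- u) = - L u.
Proof.
move=> LD Cu; have := LD _ _ Cu (CN Cu); rewrite subrr additive_on0//; lra.
Qed.

Lemma additive_onB L u v : additive_on L -> C u -> C v ->
  L (u - v) = L u - L v.
Proof. by move=> LD Cu Cv; rewrite LD// ?additive_onN//; exact: CN. Qed.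

Lemma additive_onMn L u k : additive_on L -> C u -> L (u *+ k) = L u *+ k.
Proof.
move=> LD Cu; elim: k => [|k IH]; first by rewrite !mulr0n additive_on0.
by rewrite !mulrS LD ?IH//; exact: CMn.
Qed.

(** The additive functionals dominated by [face p v] are those dominated by [p]
    whose value at [v] is the largest allowed, [p v]. Integer multiples of [v]
    suffice because only additivity is ever used, never homogeneity over [R]. *)
Definition face (p : V -> R) (v u : V) : R :=
  inf [set p (u + v *+ k) - p v *+ k | k in [set: nat]].

Let face_ge p v u k : sublinear_on p -> C u -> C v ->
  - p (- u) <= p (u + v *+ k) - p v *+ k.
Proof.
move=> sp Cu Cv; have := sublinear_mulrn_ge sp k Cv.
have := sublinearD sp (CN Cu) (CD Cu (CMn k Cv)).
by rewrite addKr; move: (p v *+ k) => c; lra.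
Qed.

Let face_has_lbound p v u : sublinear_on p -> C u -> C v ->
  has_lbound [set p (u + v *+ k) - p v *+ k | k in [set: nat]].
Proof.
by move=> sp Cu Cv; exists (- p (- u)) => _ [k _ <-]; exact: face_ge.
Qed.

Lemma face_le_mulrn p v u k : sublinear_on p -> C u -> C v ->
  face p v u <= p (u + v *+ k) - p v *+ k.
Proof.
by move=> sp Cu Cv; apply: ge_inf; [exact: face_has_lbound|exists k].
Qed.

Lemma face_le p v u : sublinear_on p -> C u -> C v -> face p v u <= p u.
Proof.
move=> sp Cu Cv; have := face_le_mulrn 0 sp Cu Cv.
by rewrite !mulr0n addr0 subr0.
Qed.

Lemma le_face (a : R) p v u :
  (forall k, a <= p (u + v *+ k) - p v *+ k) -> a <= face p v u.
Proof.
by move=> H; apply: lb_le_inf => [|_ [k _ <-]//]; exists (p (u + v *+ 0) - p v *+ 0), 0%N.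
Qed.

Let sublinear_mulrn_le p v k : sublinear_on p -> C v ->
  p (v *+ k) <= p v *+ k.
Proof.
move=> sp Cv; elim: k => [|k IH]; first by rewrite !mulr0n; exact: sublinear0.
rewrite !mulrS (le_trans (sublinearD sp _ _))//; first exact: CMn.
by rewrite lerD2l.
Qed.

Lemma face_sublinear p v : sublinear_on p -> C v -> sublinear_on (face p v).
Proof.
move=> sp Cv; split.
- by rewrite (le_trans (face_le sp C0 Cv))// sublinear0.
- move=> u w Cu Cw; rewrite -lerBlDr; apply: le_face => k.
  rewrite lerBlDr -lerBlDl; apply: le_face => l; rewrite lerBlDl.
  rewrite (le_trans (face_le_mulrn (k + l) sp (CD Cu Cw) Cv))//.
  have := sublinearD sp (CD Cu (CMn k Cv)) (CD Cw (CMn l Cv)).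
  rewrite addrACA -mulrnDr [p v *+ (k + l)]mulrnDr.
  by move: (p v *+ k) (p v *+ l) => a b; lra.
- move=> u [|m] Cu; apply: le_face => k.
    rewrite !mulr0n add0r; have := sublinear_mulrn_ge sp k Cv.
    by move: (p v *+ k) => a; lra.
  (* the expression minimized in [face] is nonincreasing in [k], so that [k]
     may be enlarged to a multiple of [m.+1] *)
  have := sublinearD sp (CD (CMn m.+1 Cu) (CMn k Cv)) (CMn (k * m) Cv).
  rewrite -addrA -mulrnDr -mulnS mulrnA -mulrnDl.
  have := sublinear_mulrn_le (k * m) sp Cv.
  have := sublinear_mulrn_ge sp m.+1 (CD Cu (CMn k Cv)).
  have : face p v u *+ m.+1 <= (p (u + v *+ k) - p v *+ k) *+ m.+1.
    by rewrite lerMn2r face_le_mulrn// orbT.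
  rewrite mulrnBl -[p v *+ k *+ _]mulrnA mulnS [p v *+ (k + _)]mulrnDr.
  move: (p v *+ k) (p v *+ _) (p (_ + _) *+ _) (face p v u *+ _) => a b c d; lra.
Qed.

Lemma face_opp p v : sublinear_on p -> C v -> face p v (- v) <= - p v.
Proof.
move=> sp Cv; have := face_le_mulrn 1 sp (CN Cv) Cv.
by rewrite !mulr1n addNr; have := sublinear0 sp; lra.
Qed.

Lemma face_dominates p v L : additive_on L -> C v ->
  (forall u, C u -> L u <= p u) -> p v <= L v ->
  forall u, C u -> L u <= face p v u.
Proof.
move=> LD Cv Lp pv u Cu; apply: le_face => k.
have := Lp _ (CD Cu (CMn k Cv)); rewrite LD ?additive_onMn//; last exact: CMn.
have : p v *+ k <= L v *+ k by rewrite lerMn2r pv orbT.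
by move: (p v *+ k) (L v *+ k) => a b; lra.
Qed.

Variables (p : V -> R) (v : nat -> V).
Hypothesis sp : sublinear_on p.
Hypothesis Cv : forall k, C (v k).

Fixpoint faces (k : nat) : V -> R :=
  if k is k'.+1 then face (faces k') (v k') else p.

(** The lexicographically largest functional below [p]: it maximizes the value at
    [v 0], then the value at [v 1] among the maximizers, and so on. *)
Definition exposed (u : V) : R := inf [set faces k u | k in [set: nat]].

Let faces_sublinear k : sublinear_on (faces k).
Proof. by elim: k => //= k IH; exact: face_sublinear. Qed.

Let faces_le k l u : C u -> (k <= l)%N -> faces l u <= faces k u.
Proof.
move=> Cu; elim: l => [|l IH]; first by rewrite leqn0 => /eqP ->.
rewrite leq_eqVlt ltnS => /predU1P[->//|/IH]; apply: le_trans.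
exact: face_le.
Qed.

Let exposed_has_lbound u : C u -> has_lbound [set faces k u | k in [set: nat]].
Proof.
move=> Cu; exists (- p (- u)) => _ [k _ <-].
have := sublinearD (faces_sublinear k) Cu (CN Cu); rewrite subrr.
have : 0 <= faces k 0.
  by have := sublinearD (faces_sublinear k) C0 C0; rewrite addr0; lra.
by have := faces_le (CN Cu) (leq0n k); rewrite /=; lra.
Qed.

Lemma exposed_le_faces k u : C u -> exposed u <= faces k u.
Proof. by move=> Cu; apply: ge_inf; [exact: exposed_has_lbound|exists k]. Qed.

Lemma exposed_le u : C u -> exposed u <= p u.
Proof. exact: (exposed_le_faces 0). Qed.

Let le_exposed a u : (forall k, a <= faces k u) -> a <= exposed u.
Proof. by move=> H; apply: lb_le_inf => [|_ [k _ <-]//]; exists (faces 0 u), 0%N. Qed.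

Lemma exposed_sublinear : sublinear_on exposed.
Proof.
split; first by rewrite (le_trans (exposed_le C0))// (sublinear0 sp).
  move=> u w Cu Cw; rewrite -lerBlDr; apply: le_exposed => k.
  rewrite lerBlDr -lerBlDl; apply: le_exposed => l; rewrite lerBlDl.
  have CuDw := CD Cu Cw.
  rewrite (le_trans (exposed_le_faces (maxn k l) CuDw))//.
  rewrite (le_trans (sublinearD (faces_sublinear _) Cu Cw))//.
  by rewrite lerD// faces_le// ?leq_maxl ?leq_maxr.
move=> u k Cu; apply: le_exposed => l.
rewrite (le_trans _ (sublinear_mulrn_ge (faces_sublinear l) k Cu))//.
by rewrite lerMn2r exposed_le_faces// orbT.
Qed.

Let exposedN_ge u : C u -> - exposed u <= exposed (- u).
Proof.
move=> Cu; have := sublinearD exposed_sublinear Cu (CN Cu); rewrite subrr.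
by have := sublinearD exposed_sublinear C0 C0; rewrite addr0; lra.
Qed.

Let exposedN_le k : exposed (- v k) <= - faces k (v k).
Proof.
apply: (le_trans (exposed_le_faces k.+1 (CN (Cv k)))).
exact: (face_opp (faces_sublinear k) (Cv k)).
Qed.

Lemma faces_le_exposed k : faces k (v k) <= exposed (v k).
Proof.
have := exposedN_le k; have := exposedN_ge (CN (Cv k)); rewrite opprK; lra.
Qed.

(** No slack is left at any stage: neither functional can exceed at [v k] the
    value that their average attains, so both attain it and both lie below the
    next face. This is extremality, in the form that ergodicity needs. *)
Lemma exposed_extreme (L1 L2 : V -> R) (a b : R) :
  additive_on L1 -> additive_on L2 -> 0 < a -> 0 < b ->
  (forall u, C u -> L1 u <= p u) -> (forall u, C u -> L2 u <= p u) ->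
  (forall u, C u -> a * L1 u + b * L2 u = (a + b) * exposed u) ->
  forall u, C u -> L1 u <= exposed u.
Proof.
move=> L1D L2D a0 b0 L1p L2p avg u Cu; apply: le_exposed => k.
suff: (forall u, C u -> L1 u <= faces k u) /\
      (forall u, C u -> L2 u <= faces k u) by case=> /(_ _ Cu).
elim: k => [//|k [IH1 IH2]] /=.
have := avg _ (Cv k); have := faces_le_exposed k.
have := IH1 _ (Cv k); have := IH2 _ (Cv k).
set F := faces k _; set E := exposed _ => h2 h1 FE e.
by split; apply: face_dominates => //; rewrite -/F; nra.
Qed.

(** A sublinear functional is additive as soon as it is odd. [exposed] is odd on
    the sequence, where each [face] has closed the gap between upper and lower
    values, and density carries this over to all of [C]. *)
Lemma exposed_additive :
  (forall u e, C u -> 0 < e ->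
    exists k, p (u - v k) <= e /\ p (v k - u) <= e) ->
  additive_on exposed.
Proof.
move=> dense; have odd w : C w -> exposed (- w) <= - exposed w.
  move=> Cw; apply/ler_addgt0Pr => e e0.
  have [k [h1 h2]] := dense w (e / 2) Cw ltac:(lra).
  have := sublinearD exposed_sublinear (CN (Cv k)) (CB (Cv k) Cw); rewrite addKr.
  have := sublinearD exposed_sublinear (Cv k) (CB Cw (Cv k)).
  rewrite (addrC (v k)) subrK.
  have := exposed_le (CB (Cv k) Cw); have := exposed_le (CB Cw (Cv k)).
  have := exposedN_le k.
  have := exposed_le_faces k (Cv k); lra.
move=> u w Cu Cw; apply/eqP; rewrite eq_le (sublinearD exposed_sublinear)//=.
have := sublinearD exposed_sublinear (CD Cu Cw) (CN Cw); rewrite addrK.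
have := odd _ Cw; lra.
Qed.

End exposed_functional.

(** * Separability of the continuous functions on a compact metric space *)

Lemma continuous_compose {X Y Z : topologicalType} (f : X -> Y) (h : Y -> Z) :
  continuous f -> continuous h -> continuous (fun x => h (f x)).
Proof. by move=> cf ch x; exact: (continuous_comp (cf x) (ch (f x))). Qed.

Lemma continuous_add_coboundary {R : realType} {X : topologicalType}
    (T : X -> X) (f h : X -> R) :
  continuous T -> continuous f -> continuous h ->
  continuous (fun x => f x + h x - h (T x)).
Proof.
move=> cT cf ch x; apply: cvgB; last exact: (continuous_compose cT ch).
by apply: cvgD; [exact: cf|exact: ch].
Qed.

Section separability.
Context {R : realType}.

Lemma nbhs_continuous_lt {X : topologicalType} (f : X -> R) (x : X) (a : R) :
  continuous f -> f x < a -> nbhs x [set y | f y < a].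
Proof. by move=> cf fxa; exact: (cf x _ (lt_nbhsl fxa)). Qed.

Definition finmin {X : Type} {T : Type} (w : T -> X -> R) (i : T) (s : seq T)
    (x : X) : R := foldr (fun j a => Num.min (w j x) a) (w i x) s.

Lemma finmin_continuous {X : topologicalType} {T : Type} (w : T -> X -> R) i s :
  (forall j, continuous (w j)) -> continuous (finmin w i s).
Proof.
move=> cw; elim: s => [|j s IH]; first exact: cw.
by move=> x; apply: (@continuous_min _ _ (w j) (finmin w i s)); [exact: cw|exact: IH].
Qed.

(** One half of the lattice form of the Stone-Weierstrass theorem: near each
    point some member of the family is close to [f], finitely many of the
    neighborhoods cover [X], and taking the minimum of the corresponding members
    preserves the lower bound [f - e]. *)
Lemma finmin_approx {X : ptopologicalType} {T : choiceType} (w : T -> X -> R)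
    (f : X -> R) (e : R) :
  compact [set: X] -> (forall i, continuous (w i)) -> continuous f ->
  (forall x, exists i, (forall y, f y - e <= w i y) /\ w i x < f x + e) ->
  exists i s, forall x, `|f x - finmin w i s x| <= e.
Proof.
move=> cX cw cf above; pose D := [set i | forall y, f y - e <= w i y].
pose O i := [set x | w i x - f x < e].
have oO i : D i -> open (O i).
  move=> _; rewrite (_ : O i = (fun x => w i x - f x) @^-1` [set r | r < e])//.
  apply: open_comp; last exact: open_lt.
  by move=> x _; apply: continuousB; [exact: cw|exact: cf].
have cov : [set: X] `<=` cover D O.
  by move=> x _; have [i [Di wix]] := above x; exists i => //; rewrite /O/=; lra.
have [D' D'D covD'] : finite_subset_cover D O [set: X].
  by move: cX; rewrite compact_cover; exact.
have [i0 Di0 _] := cov point I.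
exists i0, (finmap.enum_fset D') => x; rewrite ler_distlC; apply/andP; split.
  have : {subset finmap.enum_fset D' <= D} by [].
  elim: (finmap.enum_fset D') => [_|j s IH sub] /=; first by rewrite Di0.
  have /set_mem Dj := sub j (mem_head _ _).
  by rewrite le_min Dj IH// => k ks; apply: sub; rewrite inE ks orbT.
have [j jD' Ojx] := covD' x I.
have : finmin w i0 (finmap.enum_fset D') x <= w j x.
  have : j \in finmap.enum_fset D' by [].
  elim: (finmap.enum_fset D') => [//|k s IH] /=; rewrite inE ge_min.
  by case/predU1P=> [<-|/IH ->]; rewrite ?lexx ?orbT.
by move: Ojx; rewrite /O/=; lra.
Qed.

Lemma compact_continuous_bounded {X : ptopologicalType} (f : X -> R) :
  compact [set: X] -> continuous f -> exists M, forall x, `|f x| <= M.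
Proof.
move=> cX cf; have cnf : continuous (fun x => `|f x|).
  by move=> x; apply: continuous_comp; [exact: cf|exact: norm_continuous].
have [//||c _ fc] := @compact_EVT_max X R (fun x => `|f x|) setT _ cX.
- by exists point.
- exact: continuous_subspaceT.
by exists `|f c| => x; apply: fc; rewrite inE.
Qed.

(** The family consists of finite minima of the functions [q + N * chi], where
    [chi] vanishes on a basic open set and is at least 1 outside a larger one:
    for [q] close to [f x] and [N] large, such a function is close to [f] at
    [x] and above [f], up to a small error, everywhere. *)
Lemma continuous_functions_separable {X : pseudoPMetricType R} :
  compact [set: X] ->
  exists2 v : nat -> X -> R, forall k, continuous (v k) &
    forall f e, continuous f -> 0 < e ->
      exists k, forall x, `|f x - v k x| <= e.
Proof.
move=> cX; have [B cB [Bo Bb]] := compact_second_countable cX.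
have basicP (x : X) (U : set X) : nbhs x U -> exists V, [/\ B V, V x & V `<=` U].
  by move=> /Bb[V [BV Vx] VU]; exists V.
have /pfcard_geP[B0|[b]] := cB.
  by have [V []] := basicP point setT filterT; rewrite B0.
have {}basicP (x : X) (U : set X) : nbhs x U -> exists i, b i x /\ b i `<=` U.
  by move=> /basicP[V [/(@surj _ _ _ _ b)[i _ <-] Vx VU]]; exists i.
have bo i : open (b i) by apply/Bo/funS.
pose P i j (chi : X -> R) := [/\ continuous chi, forall x, 0 <= chi x,
  forall x, b i x -> chi x = 0 & forall x, ~ b j x -> 1 <= chi x].
pose chi i j := if pselect (exists c, P i j c) is left h
                then projT1 (cid h) else cst 0.
have chi_cont i j : continuous (chi i j).
  rewrite /chi; case: pselect => [h|_]; last by move=> x; exact: cvg_cst.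
  by case: (projT2 (cid h)).
pose w (t : nat * nat * rat * nat) x : R :=
  let: (i, j, q, N) := t in ratr q + N%:R * chi i j x.
have cw t : continuous (w t).
  case: t => -[[i j] q] N x.
  apply: cvgD.
    exact: cvg_cst.
  by apply: cvgM; [exact: cvg_cst|exact: chi_cont].
pose v k : X -> R :=
  if @unpickle ((nat * nat * rat * nat) * seq (nat * nat * rat * nat))%type k
    is Some (t, s) then finmin w t s else cst 0.
exists v => [k|f e cf e0].
  rewrite /v; case: unpickle => [[t s]|]; last by move=> x; exact: cvg_cst.
  exact: finmin_continuous.
suff /(finmin_approx cX cw cf)[t [s ts]] : forall x, exists t,
    (forall y, f y - e <= w t y) /\ w t x < f x + e.
  by exists (pickle (t, s)) => x; rewrite /v pickleK.
move=> x; have [M fM] := compact_continuous_bounded cX cf.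
have [q qin] : exists q : rat, ratr q \in `](f x - e / 2), (f x + e / 2)[.
  by apply: rat_in_itvoo; lra.
pose N := Num.truncn (2 * M); have NM : 2 * M < N.+1%:R by exact: truncnS_gt.
have [j [bjx bjf]] : exists j, b j x /\ b j `<=` [set y | f y < f x + e / 2].
  by apply/basicP/nbhs_continuous_lt => //; lra.
have [c [cc /= c01 c0 c1]] : exists c : X -> R, [/\ continuous c,
    range c `<=` `[0, 1], c @` [set x] `<=` [set 0] &
    c @` (~` b j) `<=` [set 1]].
  apply/uniform_separatorP; apply: (@uniform_completely_regular R X).
    by rewrite closedC; exact: bo.
  by move=> /(_ bjx).
have cx0 : c x = 0 by apply: c0; exists x.
have [i [bix bic]] : exists i, b i x /\ b i `<=` [set y | c y < 2^-1].
  by apply/basicP/nbhs_continuous_lt => //; rewrite cx0; lra.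
have exP : exists d, P i j d.
  exists (fun y => Num.max 0 (2 * c y - 1)); split.
  - move=> y; apply: (@continuous_max _ _ (cst 0) (fun y => 2 * c y - 1)).
      exact: cvg_cst.
    apply: continuousB; last exact: cvg_cst.
    by apply: continuousM; [exact: cvg_cst|exact: cc].
  - by move=> y; rewrite le_max lexx.
  - by move=> y /bic/= cy; apply/max_idPl; lra.
  - move=> y bjy; have -> : c y = 1 by apply: c1; exists y.
    by rewrite le_max; apply/orP; right; lra.
have [_ d0 di dj] : P i j (chi i j).
  by rewrite /chi; case: pselect => // h; exact: (projT2 (cid h)).
move: qin; rewrite in_itv/= => /andP[q1 q2].
exists (i, j, q, N.+1); split; last by rewrite /w di// mulr0; lra.
move=> y; rewrite /w; have [/bjf/= fy|/dj dy] := pselect (b j y).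
  have : 0 <= N.+1%:R * chi i j y by rewrite mulr_ge0.
  by move: (_ * _) => a; lra.
have : N.+1%:R <= N.+1%:R * chi i j y by rewrite ler_peMr.
have /ler_normlP[_ fy] := fM y; have /ler_normlP[fx _] := fM x.
by move: NM; move: (_ * chi _ _ _) => a; move: (N.+1%:R : R) => n; lra.
Qed.

End separability.

(** * The outer measure of a positive functional *)

Section mean.
Context {R : realType}.

(** Positive normalized linear functionals on the continuous functions; real
    homogeneity follows from additivity and monotonicity. *)
Record mean (X : topologicalType) := Mean {
  mean_fun :> (X -> R) -> R ;
  meanD : forall f g, continuous f -> continuous g ->
    mean_fun (fun x => f x + g x) = mean_fun f + mean_fun g ;
  le_mean : forall f g, continuous f -> continuous g ->
    (forall x, f x <= g x) -> mean_fun f <= mean_fun g ;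
  mean_cst : forall c, mean_fun (cst c) = c }.

Context {X : topologicalType}.
Implicit Types (L : mean X) (A : set X) (c : R).

Lemma meanB L (f g : X -> R) : continuous f -> continuous g ->
  L (fun x => f x - g x) = L f - L g.
Proof.
move=> cf cg; apply/eqP; rewrite eq_sym subr_eq -meanD//; last first.
  by move=> x; apply: continuousB; [exact: cf|exact: cg].
by apply/eqP; congr (mean_fun L _); apply/funext => x; rewrite subrK.
Qed.

Lemma meanN L (f : X -> R) : continuous f -> L (fun x => - f x) = - L f.
Proof.
move=> cf; rewrite -[RHS]sub0r -(mean_cst L 0) -meanB//; last first.
  by move=> x; exact: cvg_cst.
by congr (mean_fun L _); apply/funext => x; rewrite sub0r.
Qed.

Lemma mean_ge0 L (f : X -> R) : continuous f -> (forall x, 0 <= f x) -> 0 <= L f.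
Proof.
move=> cf f0; rewrite -(mean_cst L 0); apply: le_mean => // x; exact: cvg_cst.
Qed.

Lemma continuous_fun_sum n (f : 'I_n -> X -> R) : (forall i, continuous (f i)) ->
  continuous (fun x => \sum_(i < n) f i x).
Proof.
elim: n f => [|n IH] f cf x.
  by under eq_fun do rewrite big_ord0; exact: cvg_cst.
under eq_fun do rewrite big_ord_recr/=.
by apply: cvgD; [exact: IH|exact: cf].
Qed.

Lemma mean_sum L n (f : 'I_n -> X -> R) : (forall i, continuous (f i)) ->
  L (fun x => \sum_(i < n) f i x) = \sum_(i < n) L (f i).
Proof.
elim: n f => [|n IH] f cf.
  rewrite big_ord0 -[RHS](mean_cst L); congr (mean_fun L _).
  by apply/funext => x; rewrite big_ord0.
rewrite big_ord_recr/= -IH// -meanD//; last exact: continuous_fun_sum.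
by congr (mean_fun L _); apply/funext => x; rewrite big_ord_recr.
Qed.

Lemma meanMn L (f : X -> R) n : continuous f ->
  L (fun x => f x *+ n) = L f *+ n.
Proof.
move=> cf; have := @mean_sum L n (fun=> f) (fun=> cf).
rewrite sumr_const card_ord => <-; congr (mean_fun L _).
by apply/funext => x; rewrite sumr_const card_ord.
Qed.

(** An increasing sequence of continuous functions whose limit is at least the
    indicator of [A]. The limit itself is lower semicontinuous and need not be
    named. *)
Record covers (A : set X) (g : nat -> X -> R) : Prop := Covers {
  covers_continuous : forall k, continuous (g k) ;
  covers_ge0 : forall k x, 0 <= g k x ;
  covers_le : forall k l x, (k <= l)%N -> g k x <= g l x ;
  covers_ge1 : forall x e, A x -> 0 < e -> exists k, 1 - e < g k x }.

(** The outer measure of the Riesz representation theorem. Covering by limits of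
    increasing sequences, rather than by open sets, makes countable
    subadditivity a matter of adding sequences, and lets covers be multiplied
    by continuous functions, as in [riesz_cozero_cut]. *)
Definition riesz L (A : set X) : R :=
  inf [set c | exists2 g, covers A g & forall k, L (g k) <= c].

Lemma covers_cst1 A : covers A (fun=> cst 1).
Proof.
split => //; first by move=> _ x; exact: cvg_cst.
by move=> x e _ e0; exists 0%N; rewrite /cst; lra.
Qed.

Lemma riesz_le L A g c : covers A g -> (forall k, L (g k) <= c) ->
  riesz L A <= c.
Proof.
move=> Ag gc; apply: ge_inf; last by exists g.
exists 0 => d [h Ah hd]; apply: le_trans (hd 0%N).
by apply: mean_ge0; [exact: covers_continuous Ah _|exact: covers_ge0 Ah _].
Qed.

Lemma le_riesz L A a :
  (forall g c, covers A g -> (forall k, L (g k) <= c) -> a <= c) ->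
  a <= riesz L A.
Proof.
move=> H; apply: lb_le_inf => [|c [g Ag gc]]; last exact: H Ag gc.
by exists 1, (fun=> cst 1); [exact: covers_cst1|move=> _; rewrite mean_cst].
Qed.

Lemma riesz_adherent L A e : 0 < e ->
  exists g, covers A g /\ forall k, L (g k) <= riesz L A + e.
Proof.
move=> e0; apply: contrapT => /forallNP H.
suff : riesz L A + e <= riesz L A by lra.
apply: le_riesz => g c Ag gc; rewrite leNgt; apply/negP => ce.
by apply: (H g); split => // k; rewrite (le_trans (gc k))// ltW.
Qed.

Lemma riesz_ge0 L A : 0 <= riesz L A.
Proof.
apply: le_riesz => g c Ag /(_ 0%N); apply: le_trans.
by apply: mean_ge0; [exact: covers_continuous Ag _|exact: covers_ge0 Ag _].
Qed.

Lemma riesz_set0 L : riesz L set0 = 0.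
Proof.
apply/eqP; rewrite eq_le riesz_ge0 andbT.
apply: (@riesz_le _ _ (fun=> cst 0)) => [|_]; last by rewrite mean_cst.
by split => // _ x; exact: cvg_cst.
Qed.

Lemma subset_riesz L A B : A `<=` B -> riesz L A <= riesz L B.
Proof.
move=> AB; apply: le_riesz => g c [g1 g2 g3 g4]; apply: riesz_le.
by split => // x e /AB; exact: g4.
Qed.

Definition riesz_outer L (A : set X) : \bar R := (riesz L A)%:E.

(** If [g i] covers [A i], the diagonal partial sums of the [g i] cover the
    union: the [n]-th term only involves [g 0 n], ..., [g n.-1 n], hence is
    continuous. *)
Lemma riesz_sigma_subadditive L : sigma_subadditive (riesz_outer L).
Proof.
move=> A; apply/lee_addgt0Pr => e e0.
have /choice[g Hg] : forall i, exists g, covers (A i) g /\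
    forall k, L (g k) <= riesz L (A i) + e / (2 ^ i.+1)%:R.
  by move=> i; apply: riesz_adherent; rewrite divr_gt0// ltr0n expn_gt0.
have outer_ge0 n : (0 <= riesz_outer L (A n))%E by rewrite lee_fin riesz_ge0.
apply: le_trans (epsilon_trick xpredT outer_ge0 (ltW e0)).
set S := limn _; have leS n :
    (\sum_(0 <= i < n) (riesz_outer L (A i) + (e / (2 ^ i.+1)%:R)%:E) <= S)%E.
  by apply: nneseries_lim_ge => i _ _; rewrite adde_ge0// lee_fin divr_ge0// ltW.
have [SE|] := eqVneq S +oo%E; first by rewrite SE leey.
rewrite -ltey => Soo; have Sfin : S \is a fin_num.
  by rewrite ge0_fin_numE//; apply: le_trans (leS 0%N); rewrite big_geq.
rewrite /riesz_outer -(fineK Sfin) lee_fin.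
pose h n x := \sum_(i < n) g i n x.
have ch n (i : 'I_n) : continuous (g i n) by exact: covers_continuous (Hg i).1 _.
apply: (@riesz_le _ _ h); last first.
  move=> n; rewrite mean_sum// -lee_fin fineK//; apply: le_trans (leS n).
  rewrite big_mkord -sumEFin; apply: lee_sum => i _.
  by rewrite lee_fin; exact: (Hg i).2.
split.
- by move=> n; exact: continuous_fun_sum.
- by move=> n x; apply: sumr_ge0 => i _; exact: covers_ge0 (Hg i).1 _ _.
- move=> k l x kl; rewrite /h -!(big_mkord xpredT (fun i => g i _ x)).
  rewrite [leRHS](big_cat_nat (leq0n k) kl)/= -[leLHS]addr0 lerD//.
    by apply: ler_sum => i _; exact: covers_le (Hg i).1 _ _ _ kl.
  by apply: sumr_ge0 => i _; exact: covers_ge0 (Hg i).1 _ _.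
- move=> x d [i _ Aix] d0; have [k gk] := covers_ge1 (Hg i).1 Aix d0.
  exists (maxn k i.+1); apply: (lt_le_trans gk).
  have ik : (i < maxn k i.+1)%N by rewrite leq_max leqnn orbT.
  rewrite /h (bigD1 (Ordinal ik))//= -[leLHS]addr0 lerD//.
    by apply: covers_le (Hg i).1 _ _ _ _; rewrite leq_maxl.
  by apply: sumr_ge0 => j _; exact: covers_ge0 (Hg j).1 _ _.
Qed.

HB.instance Definition _ L := isOuterMeasure.Build R X (riesz_outer L)
  (congr1 EFin (riesz_set0 L)) (fun A => riesz_ge0 L A)
  (fun A B AB => subset_riesz L AB) (@riesz_sigma_subadditive L).

(** Cutting a cover [g] of [A] along [{h > 0}]: with [u k] increasing to the
    indicator of this set, [g k * u k] covers the part of [A] inside and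
    [g k * (1 - u J)] the part outside, and for [J] large the two costs add up
    to hardly more than that of [g]. *)
Lemma riesz_cozero_cut L (h : X -> R) A : continuous h ->
  riesz L (A `&` [set x | 0 < h x]) + riesz L (A `&` ~` [set x | 0 < h x]) <=
  riesz L A.
Proof.
move=> ch; apply: le_riesz => g c Ag gc.
pose u k x : R := Num.min 1 (k%:R * Num.max 0 (h x)).
have hp x : 0 <= Num.max 0 (h x) by rewrite le_max lexx.
have cu k : continuous (u k).
  move=> x; apply: (@continuous_min _ _ (cst 1)
      (fun x => k%:R * Num.max 0 (h x))); first exact: cvg_cst.
  apply: cvgM; first exact: cvg_cst.
  by apply: (@continuous_max _ _ (cst 0) h); [exact: cvg_cst|exact: ch].
have u0 k x : 0 <= u k x by rewrite le_min ler01 mulr_ge0.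
have u1 k x : u k x <= 1 by rewrite ge_min lexx.
have ule k l x : (k <= l)%N -> u k x <= u l x.
  move=> kl; rewrite /u le_min ge_min lexx/= ge_min; apply/orP; right.
  by rewrite ler_wpM2r// ler_nat.
have cg := covers_continuous Ag; have g0 := covers_ge0 Ag.
have gle := covers_le Ag.
have cgu k l : continuous (fun x => g k x * u l x).
  by move=> x; apply: cvgM; [exact: cg|exact: cu].
have Lguc k : L (fun x => g k x * u k x) <= c.
  by apply: le_trans (gc k); apply: le_mean => // x; rewrite ler_piMr.
pose E := [set L (fun x => g k x * u k x) | k in [set: nat]].
have supE : has_sup E.
  by split; [exists (L (fun x => g 0%N x * u 0%N x)), 0%N|exists c => _ [k _ <-]].
have inside : riesz L (A `&` [set x | 0 < h x]) <= sup E.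
  apply: (@riesz_le _ _ (fun k x => g k x * u k x)); last first.
    by move=> k; apply: ub_le_sup; [exact: supE.2|exists k].
  split => //.
  - by move=> k x; rewrite mulr_ge0.
  - by move=> k l x kl; rewrite ler_pM// ?gle ?ule.
  - move=> x e [Ax /= hx] e0; have [k gk] := covers_ge1 Ag Ax e0.
    (* large enough for [u m x] to have reached 1 *)
    pose m := (Num.truncn (h x)^-1).+1.
    have um : u m x = 1.
      apply/min_idPl; rewrite (max_idPr (ltW hx)) -ler_pdivrMr// mul1r.
      exact/ltW/truncnS_gt.
    exists (maxn k m); rewrite (_ : u _ x = 1) ?mulr1; last first.
      by apply/eqP; rewrite eq_le u1/= -{1}um ule// leq_maxr.
    by apply: (lt_le_trans gk); rewrite gle// leq_maxl.
apply/ler_addgt0Pr => e e0.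
have [_ [J _ <-] supJ] := sup_adherent e0 supE.
(* the outer cover starts at index [J], where [supJ] bounds its cost *)
suff outside : riesz L (A `&` ~` [set x | 0 < h x]) <= c - (sup E - e).
  by move: inside outside; lra.
apply: (@riesz_le _ _ (fun k x => g (k + J)%N x - g (k + J)%N x * u J x)).
  split.
  - by move=> k x; apply: cvgB; [exact: cg|exact: cgu].
  - by move=> k x; rewrite subr_ge0 ler_piMr.
  - move=> k l x kl.
    have := gle _ _ x (leq_add kl (leqnn J)); have := u1 J x.
    by move=> uJ gkl; nra.
  - move=> x d [Ax /= /negP]; rewrite -leNgt => hx d0.
    have [k gk] := covers_ge1 Ag Ax d0; exists k.
    rewrite (_ : u J x = 0) ?mulr0 ?subr0.
      by apply: (lt_le_trans gk); rewrite gle// leq_addr.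
    by rewrite /u (max_idPl hx) mulr0; apply/min_idPr.
move=> k; rewrite meanB//; apply: lerB; first exact: gc.
apply: (le_trans (ltW supJ)); apply: le_mean => // x.
by rewrite ler_wpM2r// gle// leq_addl.
Qed.

Lemma cozero_caratheodory L (h : X -> R) : continuous h ->
  (riesz_outer L).-caratheodory [set x | 0 < h x].
Proof.
by move=> ch; apply: le_caratheodory_measurable => A; rewrite -EFinD lee_fin riesz_cozero_cut.
Qed.

End mean.

Arguments mean : clear implicits.

(** * The Riesz representation theorem *)

Section riesz_representation.
Context {R : realType} {X : pseudoPMetricType R}.
Hypothesis cX : compact [set: X].
Local Notation Y := (g_sigma_algebraType (@open X)).
Implicit Types (L : mean R X) (mu : probability Y R).

(** A bump function at a point of [U] is close to a member of the dense sequence,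
    so that the members positive only inside [U] exhaust [U]. *)
Lemma open_bigcup_cozero (U : set X) : open U ->
  exists2 v : nat -> X -> R, forall k, continuous (v k) &
    U = \bigcup_k [set x | 0 < v k x].
Proof.
move=> oU; have [v cv dv] := continuous_functions_separable cX.
pose w k := if pselect ([set x | 0 < v k x] `<=` U) then v k else cst 0.
exists w => [k|].
  by rewrite /w; case: pselect => [?|? x]; [exact: cv|exact: cvg_cst].
rewrite eqEsubset; split => [x Ux|x [k _] /=]; last first.
  by rewrite /w; case: pselect => [sub|?]; [exact: sub|rewrite /cst ltxx].
have [c [cc /= _ c0 c1]] : exists c : X -> R, [/\ continuous c,
    range c `<=` `[0, 1], c @` [set x] `<=` [set 0] &
    c @` (~` U) `<=` [set 1]].
  apply/uniform_separatorP; apply: (@uniform_completely_regular R X).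
    by rewrite closedC.
  by move=> /(_ Ux).
have [||k vk] := dv (fun y => 2^-1 - c y) 4^-1.
- by move=> y; apply: cvgB; [exact: cvg_cst|exact: cc].
- by rewrite invr_gt0.
exists k => //; rewrite /= /w; case: pselect => [?|[]].
  by have /ler_normlP[_] := vk x; rewrite /= (_ : c x = 0); [lra|apply: c0; exists x].
move=> y /= vky; apply: contrapT => Uy.
by have /ler_normlP[] := vk y; rewrite /= (_ : c y = 1); [lra|apply: c1; exists y].
Qed.

Lemma borel_caratheodory L :
  (measurable : set (set Y)) `<=` (riesz_outer L).-caratheodory.
Proof.
apply: smallest_sub.
  split => /=.
  - exact: caratheodory_measurable_set0.
  - by move=> A mA; rewrite setTD; exact: caratheodory_measurable_setC.
  - by move=> F mF; exact: caratheodory_measurable_bigcup.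
move=> U /open_bigcup_cozero[v cv ->].
apply: caratheodory_measurable_bigcup => k.
exact: cozero_caratheodory.
Qed.

(** By compactness a single member of a cover exceeds [1 - e] everywhere. *)
Lemma riesz_setT L : riesz L setT = 1.
Proof.
apply/eqP; rewrite eq_le; apply/andP; split.
  apply: (@riesz_le _ _ _ _ (fun=> cst 1)); first exact: covers_cst1.
  by move=> _; rewrite mean_cst.
apply: le_riesz => g c Tg gc; apply/ler_addgt0Pr => e e0.
have [D _ covD] : finite_subset_cover setT (fun k => [set x | 1 - e < g k x]) [set: X].
  move: cX; rewrite compact_cover; apply => [k _|x _].
    rewrite (_ : [set x | _] = g k @^-1` [set r | 1 - e < r])//.
    by apply: open_comp; [move=> x _; exact: covers_continuous Tg _ _|exact: open_gt].
  by have [k gk] := covers_ge1 Tg (I : setT x) e0; exists k.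
pose N := \max_(k <- finmap.enum_fset D) k.
rewrite -lerBlDr (le_trans _ (gc N))// -(mean_cst L (1 - e)); apply: le_mean.
- by move=> x; exact: cvg_cst.
- exact: covers_continuous Tg _.
move=> x; have [k kD gk] := covD x Logic.I; apply: (le_trans (ltW gk)).
by apply: (covers_le Tg); rewrite /N (big_rem k)//= leq_maxl.
Qed.

Lemma riesz_probability L :
  exists mu, forall A, mu A = (riesz L A)%:E.
Proof.
have add : semi_sigma_additive (riesz_outer L : set Y -> \bar R).
  move=> F mF tF mUF; apply: (@caratheodory_measure_sigma_additive _ _ (riesz_outer L)) => //.
    by move=> k; exact: borel_caratheodory.
  exact: borel_caratheodory.
pose mM := isMeasure.Build _ Y R (riesz_outer L : set Y -> \bar R)
  (outer_measure0 _) (outer_measure_ge0 _) add.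
pose m : {measure set Y -> \bar R} := HB.pack (riesz_outer L : set Y -> \bar R) mM.
have mT : m setT = 1%E by rewrite /m/= /riesz_outer riesz_setT.
pose mP := Measure_isProbability.Build _ Y R m mT.
pose mp : probability Y R := HB.pack (riesz_outer L : set Y -> \bar R) mM mP.
by exists mp.
Qed.

Lemma continuous_measurable_borel (f : X -> R) : continuous f ->
  measurable_fun [set: Y] (f : Y -> R).
Proof.
move=> /continuousP cf; apply: (measurability _ (RGenOpens.measurableE R)).
move=> _ [_ [a [b ->] <-]]; rewrite setTI; apply: sub_sigma_algebra.
exact/cf/interval_open.
Qed.

Lemma continuous_self_measurable_borel (f : X -> X) : continuous f ->
  measurable_fun [set: Y] (f : Y -> Y).
Proof.
move=> /continuousP cf; apply: (@measurability _ _ Y Y setT f (@open X) erefl).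
by move=> _ [U oU <-]; rewrite setTI; apply: sub_sigma_algebra; exact: cf.
Qed.

Lemma continuous_integrable mu (A : set Y) (f : X -> R) :
  measurable A -> continuous f -> mu.-integrable A (EFin \o (f : Y -> R)).
Proof.
move=> mA cf; apply: measurable_bounded_integrable => //.
- exact: le_lt_trans (probability_le1 mu mA) (ltry 1).
- by apply: measurable_funTS; exact: continuous_measurable_borel.
have [M fM] := compact_continuous_bounded cX cf.
by exists M; split; [exact: num_real|move=> r Mr x _; apply: (le_trans (fM x)); exact: ltW].
Qed.

Lemma cozero_measurable (f : X -> R) : continuous f ->
  measurable ([set x | 0 < f x] : set Y).
Proof.
move=> cf; apply: sub_sigma_algebra.
rewrite (_ : [set x | _] = f @^-1` [set r | 0 < r])//.
by apply: open_comp; [move=> x _; exact: cf|exact: open_gt].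
Qed.

Section integral.
Variables (L : mean R X) (mu : probability Y R).
Hypothesis muE : forall A, measurable A -> mu A = (riesz L A)%:E.

(** Peeling off [min f 1] lowers the bound on [f] by 1; its integral is at most
    the measure of [{f > 0}], while its mean is at least the measure of
    [{f > 1}], which is the set where the remainder is positive. *)
Lemma integral_le_mean_measure N (f : X -> R) : continuous f ->
  (forall x, 0 <= f x <= N%:R) ->
  \int[mu]_x f x <= fine (mu [set x | 0 < f x]) + L f.
Proof.
elim: N f => [|N IH] f cf f0N.
  have f0 x : f x = 0 by apply/eqP; rewrite eq_le andbC; exact: f0N.
  rewrite (eq_Rintegral mu (g := cst 0))//.
  rewrite Rintegral_cst//= mul0r addr_ge0// ?fine_ge0//.
  by apply: mean_ge0 => // x; rewrite f0.
pose m x := Num.min (f x) 1; pose r x := f x - m x.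
have cm : continuous m.
  by move=> x; apply: (@continuous_min _ _ f (cst 1)); [exact: cf|exact: cvg_cst].
have cr : continuous r by move=> x; apply: cvgB; [exact: cf|exact: cm].
have fE x : f x = m x + r x by rewrite /r addrC subrK.
have r0N x : 0 <= r x <= N%:R.
  have /andP[fx0 fxN] := f0N x; rewrite -natr1 in fxN; rewrite /r /m.
  by case: (leP (f x) 1) => fx1; [rewrite subrr lexx/=|lra].
have ->: \int[mu]_x f x = \int[mu]_x m x + \int[mu]_x r x.
  rewrite -RintegralD//; [|exact: continuous_integrable..].
  by apply: eq_Rintegral => x _; exact: fE.
have -> : L f = L m + L r.
  by rewrite -meanD//; congr (mean_fun L _); apply/funext.
have Im : \int[mu]_x m x <= fine (mu [set x | 0 < f x]).
  have mf := cozero_measurable cf.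
  have -> : fine (mu [set x | 0 < f x]) = \int[mu]_x \1_[set x : Y | 0 < f x] x.
    by rewrite /Rintegral integral_indic// setIT.
  apply: le_Rintegral => //.
  - exact: continuous_integrable.
  - exact: integrable_indic.
  move=> x _; rewrite /m indicE; have := f0N x.
  case: (boolP (x \in _)) => [_ _|]; first by rewrite ge_min lexx orbT.
  by rewrite notin_setE/= => /negP; rewrite -leNgt ge_min => ->.
have mur : fine (mu [set x | 0 < r x]) <= L m.
  rewrite muE; last exact: cozero_measurable.
  apply: (@riesz_le _ _ _ _ (fun=> m)) => //; split => // [_ x|x e /= rx e0].
    by rewrite /m le_min ler01 andbT; case/andP: (f0N x).
  exists 0%N; move: rx; rewrite /r /m; case: (leP (f x) 1) => _; last by lra.
  by rewrite subrr ltxx.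
by have := IH r cr r0N; lra.
Qed.

(** The error term [mu {f > 0}] of the previous lemma is at most 1, and becomes
    negligible when the lemma is applied to large multiples of [f]; adding a
    constant removes the sign condition, and [- f] gives the other inequality. *)
Lemma riesz_representation (f : X -> R) : continuous f ->
  \int[mu]_x f x = L f.
Proof.
have le1 (g : X -> R) : continuous g -> (forall x, 0 <= g x) -> \int[mu]_x g x <= 1 + L g.
  move=> cg g0; have [M gM] := compact_continuous_bounded cX cg.
  apply: le_trans (@integral_le_mean_measure (Num.truncn M).+1 g cg _) _.
    move=> x; rewrite g0/= (le_trans (ler_norm _))// (le_trans (gM x))//.
    exact/ltW/truncnS_gt.
  rewrite lerD2r -lee_fin fineK ?fin_num_measure//; last exact: cozero_measurable.
  by apply: probability_le1; exact: cozero_measurable.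
have le0 (g : X -> R) : continuous g -> (forall x, 0 <= g x) -> \int[mu]_x g x <= L g.
  move=> cg g0; rewrite leNgt; apply/negP => lt.
  pose n := (Num.truncn (\int[mu]_x g x - L g)^-1).+1.
  have cgn : continuous (fun x => g x *+ n).
    by move=> x; exact: (cvgMn (n := n) (cg x)).
  have := le1 _ cgn (fun x => mulrn_wge0 n (g0 x)).
  rewrite meanMn// (eq_Rintegral mu (g := fun x => n%:R * g x)); last first.
    by move=> x _; rewrite mulr_natl.
  rewrite RintegralZl//; last exact: continuous_integrable.
  have : (\int[mu]_x g x - L g)^-1 < n%:R by exact: truncnS_gt.
  rewrite invf_plt ?posrE ?subr_gt0// ?ltr0n//.
  rewrite -[n%:R^-1]mul1r ltr_pdivrMr ?ltr0n// -[L g *+ n]mulr_natl.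
  by move: (n%:R : R) => b; lra.
have le (g : X -> R) : continuous g -> \int[mu]_x g x <= L g.
  move=> cg; have [M gM] := compact_continuous_bounded cX cg.
  have cM : continuous (cst M : X -> R) by move=> x; exact: cvg_cst.
  have := le0 (fun x => g x + M); rewrite meanD// mean_cst RintegralD//; last 2 first.
    exact: continuous_integrable.
    exact: (continuous_integrable _ _ cM).
  rewrite Rintegral_cst//= probability_setT/= mulr1 lerD2r; apply.
    by move=> x; apply: cvgD; [exact: cg|exact: cvg_cst].
  by move=> x; have /ler_normlP[] := gM x; lra.
move=> cf; apply/eqP; rewrite eq_le le//=.
have := le (fun x => - f x); rewrite meanN// => /(_ _).
under eq_Rintegral do rewrite -mulN1r.
rewrite RintegralZl//; last exact: continuous_integrable.
rewrite mulN1r lerN2; apply => x; apply: cvgN; exact: cf.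
Qed.

End integral.
End riesz_representation.

(** * Ergodic maximizing measures *)

Lemma invariant_Rintegral {d} {Y : measurableType d} {R : realType}
    (mu : probability Y R) (T : Y -> Y) (A : set Y) (f : Y -> R) :
  measurable_fun setT T -> invariant_measure T mu ->
  measurable A -> T @^-1` A = A -> measurable_fun setT f ->
  mu.-integrable A (EFin \o (f \o T)) ->
  \int[mu]_(x in A) f (T x) = \int[mu]_(x in A) f x.
Proof.
move=> mT inv mA TA mf intf; rewrite /Rintegral; congr fine.
have := @integral_pushforward _ _ _ _ _ _ mT mu A (EFin \o f).
rewrite TA => <-//; last exact/measurable_EFinP.
by apply: eq_measure_integral => B mB _; exact: inv.
Qed.

Section ergodic_optimization.
Context {R : realType} {X : pseudoPMetricType R}.
Hypothesis cX : compact [set: X].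
Variable T : X -> X.
Hypothesis cT : continuous T.
Local Notation Y := (g_sigma_algebraType (@open X)).
Local Notation C := [set f : X -> R | continuous f].

Let C0 : C 0. Proof. by move=> x; exact: cvg_cst. Qed.

Let CB f g : C f -> C g -> C (f - g).
Proof. by move=> cf cg x; apply: cvgB; [exact: cf|exact: cg]. Qed.

Let cTh (h : X -> R) : continuous h -> continuous (fun x => h (T x)).
Proof. exact: continuous_compose. Qed.

Let mulrn_fun (f : X -> R) k x : (f *+ k) x = f x *+ k.
Proof. by elim: k => [|k IH] //; rewrite !mulrS -IH. Qed.

(** The largest integral of [f] against an invariant probability measure, in
    dual form: adding a coboundary [h - h \o T] to [f] leaves these integrals
    unchanged, and the best uniform bound obtained in this way is sharp. *)
Definition max_average (f : X -> R) : R :=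
  inf [set c | exists2 h : X -> R, continuous h &
                 forall x, f x + h x - h (T x) <= c].

(** Evaluation where [h] is largest makes [h x - h (T x)] nonnegative. *)
Let max_average_ge (f h : X -> R) c : continuous h ->
  (forall x, f x + h x - h (T x) <= c) -> exists x, f x <= c.
Proof.
move=> ch fc; have [//||x _ hx] := @compact_EVT_max X R h setT _ cX.
- by exists point.
- exact: continuous_subspaceT.
by exists x; have := fc x; have := hx (T x) (mem_setT _); lra.
Qed.

Let has_inf_max_average (f : X -> R) : continuous f ->
  has_inf [set c | exists2 h : X -> R, continuous h &
                     forall x, f x + h x - h (T x) <= c].
Proof.
move=> cf; have [M fM] := compact_continuous_bounded cX cf; split.
  exists M, (cst 0); first by move=> x; exact: cvg_cst.
  by move=> x; rewrite /cst addr0 subr0; have /ler_normlP[] := fM x.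
exists (- M) => c [h ch /(max_average_ge ch)[x]]; apply: le_trans.
by have /ler_normlP[] := fM x; lra.
Qed.

Lemma max_average_le (f h : X -> R) c : continuous f -> continuous h ->
  (forall x, f x + h x - h (T x) <= c) -> max_average f <= c.
Proof.
by move=> cf ch fc; apply: ge_inf; [exact: (has_inf_max_average cf).2|exists h].
Qed.

Lemma max_average_le_bound (f : X -> R) c : continuous f ->
  (forall x, f x <= c) -> max_average f <= c.
Proof.
have c0 : continuous (cst 0 : X -> R) by move=> x; exact: cvg_cst.
by move=> cf fc; apply: (max_average_le cf c0) => x; rewrite /cst addr0 subr0.
Qed.

Lemma max_average_lt (f : X -> R) c : continuous f -> max_average f < c ->
  exists2 h : X -> R, continuous h & forall x, f x + h x - h (T x) < c.
Proof.
move=> cf; rewrite -subr_gt0 => fc.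
have [c' [h ch hc']] := inf_adherent fc (has_inf_max_average cf).
by rewrite addrC subrK => c'c; exists h => // x; exact: le_lt_trans (hc' x) c'c.
Qed.

Lemma le_max_average (f : X -> R) a : continuous f ->
  (forall (h : X -> R) c, continuous h ->
    (forall x, f x + h x - h (T x) <= c) -> a <= c) ->
  a <= max_average f.
Proof.
move=> cf H; apply: lb_le_inf; first exact: (has_inf_max_average cf).1.
by move=> c [h ch hc]; exact: H ch hc.
Qed.

Lemma max_average_sublinear : sublinear_on C max_average.
Proof.
split.
- exact: max_average_le_bound.
- move=> f g cf cg; have cfg : continuous (f + g).
    by move=> x; apply: cvgD; [exact: cf|exact: cg].
  rewrite -lerBlDr; apply: le_max_average => // h c ch hc.
  rewrite lerBlDr -lerBlDl; apply: le_max_average => // k d ck kd.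
  rewrite lerBlDl; apply: (@max_average_le _ (fun x => h x + k x)) => //.
    by move=> x; apply: cvgD; [exact: ch|exact: ck].
  move=> x; have := hc x; have := kd x; have -> : (f + g) x = f x + g x by [].
  by lra.
- move=> f k cf; have cfk : continuous (f *+ k).
    rewrite (_ : f *+ k = fun x => f x *+ k); last exact/funext/mulrn_fun.
    by move=> x; exact: (cvgMn (n := k) (cf x)).
  apply: le_max_average => // h c ch hc; case: k => [|k] in cfk hc *.
    have [x] := max_average_ge ch hc.
    by rewrite mulrn_fun !mulr0n.
  rewrite -mulr_natr -ler_pdivlMr ?ltr0n//.
  apply: (@max_average_le _ (fun x => h x / k.+1%:R)) => //.
    by move=> x; apply: cvgM; [exact: ch|exact: cvg_cst].
  move=> x; rewrite ler_pdivlMr ?ltr0n// mulrBl mulrDl !divfK ?pnatr_eq0//.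
  by have := hc x; rewrite mulrn_fun mulr_natr.
Qed.

Section extremal_measure.
Variable v : nat -> X -> R.
Hypothesis cv : forall k, continuous (v k).
Hypothesis v_dense : forall f e, continuous f -> 0 < e ->
  exists k, forall x, `|f x - v k x| <= e.

Let E := exposed max_average v.

Let E_additive : additive_on C E.
Proof.
apply: exposed_additive => //; first exact: max_average_sublinear.
move=> f e cf e0; have [k fk] := v_dense cf e0; exists k.
split; (apply: max_average_le_bound => [|x]; first exact: CB).
  by have /ler_normlP[_] := fk x.
by have /ler_normlP[+ _] := fk x; rewrite opprB.
Qed.

Let E_le (f : X -> R) : continuous f -> E f <= max_average f.
Proof. exact: (exposed_le C0 CB max_average_sublinear cv). Qed.

Let E_le_bound (f : X -> R) c : continuous f -> (forall x, f x <= c) -> E f <= c.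
Proof.
by move=> cf fc; rewrite (le_trans (E_le cf))// max_average_le_bound.
Qed.

Let le_E (f g : X -> R) : continuous f -> continuous g ->
  (forall x, f x <= g x) -> E f <= E g.
Proof.
move=> cf cg fg; rewrite -subr_le0 -(additive_onB C0 CB E_additive)//.
by apply: E_le_bound => [|x]; [exact: CB|rewrite subr_le0].
Qed.

Let E_cst c : E (cst c) = c.
Proof.
have cc a : continuous (cst a : X -> R) by move=> x; exact: cvg_cst.
apply/eqP; rewrite eq_le E_le_bound//= -lerN2.
rewrite -(additive_onN C0 CB E_additive)//; apply: E_le_bound => // x.
by apply: cvgN; exact: cc.
Qed.

Definition exposed_mean : mean R X := Mean E_additive le_E E_cst.
Let L := exposed_mean.

Let L_invariant (f : X -> R) : continuous f -> L (fun x => f (T x)) = L f.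
Proof.
move=> cf; have cfT := cTh cf; apply/eqP; rewrite eq_le.
apply/andP; split; rewrite -subr_le0 -meanB//; (apply: le_trans; first by apply: E_le; exact: CB).
  by apply: (@max_average_le _ f) => [|//|x]; [exact: CB|lra].
apply: (@max_average_le _ (fun x => - f x)) => [||x]; [exact: CB| |lra].
by move=> x; apply: cvgN; exact: cf.
Qed.

Let riesz_preimage_le (A : set X) : riesz L (T @^-1` A) <= riesz L A.
Proof.
apply: le_riesz => g c Ag gc; apply: (@riesz_le _ _ _ _ (fun k x => g k (T x))).
  split.
  - by move=> k; apply: cTh; exact: covers_continuous Ag _.
  - by move=> k x; exact: covers_ge0 Ag _ _.
  - by move=> k l x; exact: covers_le Ag _ _ _.
  - by move=> x e Ax e0; exact: (covers_ge1 Ag (Ax : A (T x)) e0).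
by move=> k; rewrite L_invariant//; exact: covers_continuous Ag _.
Qed.

Variable mu : probability Y R.
Hypothesis muE : forall A, mu A = (riesz L A)%:E.

Let mT : measurable_fun [set: Y] (T : Y -> Y).
Proof. exact: continuous_self_measurable_borel. Qed.

Let riesz_setC (A : set Y) : measurable A -> riesz L (~` A) = 1 - riesz L A.
Proof.
by move=> mA; have := probability_setC mu mA; rewrite !muE -EFinB => -[].
Qed.

(** Composing a cover with [T] keeps its cost; the reverse inequality comes from
    the complement. *)
Lemma exposed_measure_invariant : invariant_measure (T : Y -> Y) mu.
Proof.
move=> A mA; rewrite !muE; congr EFin; apply/eqP; rewrite eq_le riesz_preimage_le/=.
have := riesz_preimage_le (~` A); rewrite preimage_setC !riesz_setC//; first by lra.
by have := mT measurableT mA; rewrite setTI.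
Qed.

(** Restriction to an invariant set [A] yields functionals averaging to [L], so
    that the integral over [A] is [mu A] times the whole integral. Hence a cover
    of [A] of cost [c] satisfies [mu A <= mu A * c], so that [1 <= c] when
    [mu A] is positive. *)
Lemma exposed_measure_ergodic : ergodic_measure (T : Y -> Y) mu.
Proof.
move=> A mA TA; set a := riesz L A.
have muA : mu A = a%:E by exact: muE.
have a1 : a <= 1 by rewrite -lee_fin -muA probability_le1.
have [az|aneq0] := eqVneq a 0; [by left; rewrite muA az|right].
have a0 : 0 < a by rewrite lt_neqAle eq_sym aneq0 riesz_ge0.
rewrite muA; congr EFin; apply/eqP; rewrite eq_le a1/=.
rewrite leNgt; apply/negP => alt1.
have mCA : measurable (~` A : set Y) by exact: measurableC.
have TCA : T @^-1` (~` A) = ~` A by rewrite -[in RHS]TA.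
have muCA : mu (~` A) = (1 - a)%:E by rewrite muE riesz_setC.
pose avg (B : set Y) (f : X -> R) := (\int[mu]_(x in B) f x) / fine (mu B).
have int (B : set Y) (f : X -> R) : measurable B -> continuous f ->
    mu.-integrable B (EFin \o (f : Y -> R)).
  exact: continuous_integrable.
have avgD (B : set Y) : measurable B -> additive_on C (avg B).
  by move=> mB f g cf cg; rewrite /avg RintegralD ?mulrDl//; exact: int.
have avg_le (B : set Y) : measurable B -> T @^-1` B = B -> 0 < fine (mu B) ->
    forall f, C f -> avg B f <= max_average f.
  move=> mB TB B0 f cf; apply: le_max_average => // h c ch hc.
  rewrite /avg ler_pdivrMr//.
  have chT := cTh ch.
  have cfh : continuous (fun x => f x + h x).
    by move=> x; apply: cvgD; [exact: cf|exact: ch].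
  have -> : \int[mu]_(x in B) f x = \int[mu]_(x in B) (f x + h x - h (T x)).
    rewrite RintegralB ?RintegralD//; try exact: int.
    rewrite (@invariant_Rintegral _ _ _ mu T B h)//; try exact: int.
    - by rewrite addrK.
    - exact: exposed_measure_invariant.
    - exact: continuous_measurable_borel.
  rewrite -Rintegral_cst//; apply: le_Rintegral => //.
    by apply: int => // x; apply: cvgB; [exact: cfh|exact: chT].
  by apply: (int _ (cst c)) => // x; exact: cvg_cst.
have avg_sum f : C f -> a * avg A f + (1 - a) * avg (~` A) f = (a + (1 - a)) * E f.
  move=> cf; rewrite /avg muA muCA/= [a * _]mulrC divfK//.
  rewrite [(1 - a) * _]mulrC divfK ?gt_eqF ?subr_gt0//.
  rewrite [a + _]addrC subrK mul1r -[RHS]/(L f).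
  have disj : [disjoint A & ~` A] by apply/disj_setPS; rewrite setICr.
  have intT : mu.-integrable (A `|` ~` A) (EFin \o (f : Y -> R)).
    by rewrite setUv; exact: int.
  rewrite -(riesz_representation cX (fun A _ => muE A) cf).
  by rewrite -Rintegral_setU// setUv.
have avgA f : C f -> avg A f <= E f.
  apply: (exposed_extreme C0 CB max_average_sublinear cv (avgD _ mA) (avgD _ mCA) a0 _ _ _ avg_sum).
  - by rewrite subr_gt0.
  - by apply: avg_le => //; rewrite muA.
  - by apply: avg_le => //; rewrite muCA/= subr_gt0.
suff : 1 <= a by lra.
apply: le_riesz => g c Ag gc; apply/ler_addgt0Pr => e e0.
suff: (1 - e) * a <= c * a by rewrite ler_pM2r//; lra.
pose F k := A `&` [set x | 0 < g k x - (1 - e)].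
have cg := covers_continuous Ag.
have mF k : measurable (F k : set Y).
  apply: measurableI => //; apply: cozero_measurable => x.
  by apply: cvgB; [exact: cg|exact: cvg_cst].
have Fcvg : mu (F k) @[k --> \oo] --> mu A.
  have AE : A = \bigcup_k F k.
    rewrite eqEsubset; split=> [x Ax|x [k _ []]//].
    have [k gk] := covers_ge1 Ag Ax e0; exists k => //; split => //=; lra.
  rewrite [X in _ --> mu X]AE; apply: nondecreasing_cvg_mu => //.
    by rewrite -AE.
  move=> k l kl; apply/subsetPset => x [Ax /= gk]; split => //=.
  by have := covers_le Ag x kl; lra.
have leF k : (1 - e) * fine (mu (F k)) <= c * a.
  have -> : (1 - e) * fine (mu (F k)) = \int[mu]_(x in A) ((1 - e) * \1_(F k) x).
    rewrite RintegralZl//; last first.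
      by apply: (integrableS measurableT) => //; exact: integrable_indic.
    by rewrite /Rintegral integral_indic// -setIA (setIC _ A) setIA setIid.
  have : avg A (g k) <= c by rewrite (le_trans (avgA _ (cg k)))//; exact: gc.
  rewrite /avg muA/= ler_pdivrMr//; apply: le_trans; apply: le_Rintegral => //.
  - apply: (integrableS measurableT) => //.
    exact: (integrableZl measurableT (1 - e) (integrable_indic mu (mF k))).
  - exact: int.
  move=> x Ax; rewrite indicE; case: (boolP (x \in F k)) => [/set_mem[_ /=]|_].
    by rewrite mulr1; lra.
  by rewrite mulr0; exact: covers_ge0 Ag _ _.
have lim : (1 - e) * fine (mu (F k)) @[k --> \oo] --> (1 - e) * a.
  by apply: cvgMl_tmp; apply: fine_cvg; rewrite -muA.
by apply: (cvgr_to_le lim); apply: nearW => k; exact: leF.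
Qed.

End extremal_measure.

(** The measure maximizes the integral of [phi] first, then those of a dense
    sequence of functions one after the other; these values determine it, hence
    it is extreme among the invariant measures, hence ergodic. Without strictly
    negative [phi + h - h \o T], the maximal integral of [phi] is
    nonnegative. *)
Theorem ergodic_maximizing_measure (phi : X -> R) : continuous phi ->
  (forall h : X -> R, continuous h ->
    exists x, 0 <= phi x + h x - h (T x)) ->
  exists mu : probability Y R,
    [/\ invariant_measure (T : Y -> Y) mu, ergodic_measure (T : Y -> Y) mu &
        0 <= \int[mu]_x phi x].
Proof.
move=> cphi phi0; have [v cv dv] := continuous_functions_separable cX.
pose w k := if k is k'.+1 then v k' else phi.
have cw k : continuous (w k) by case: k => [|k]; [exact: cphi|exact: cv].
have dw f e : continuous f -> 0 < e ->
    exists k, forall x, `|f x - w k x| <= e.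
  by move=> cf e0; have [k] := dv f e cf e0; exists k.+1.
pose L := exposed_mean cw dw.
have [mu muL] := riesz_probability cX L.
exists mu; split.
- exact: exposed_measure_invariant muL.
- exact: exposed_measure_ergodic muL.
rewrite (riesz_representation cX (fun A _ => muL A) cphi).
apply: le_trans (faces_le_exposed C0 CB max_average_sublinear cw 0) => /=.
rewrite leNgt; apply/negP => /(max_average_lt cphi)[h ch hphi].
by have [x] := phi0 h ch; rewrite leNgt hphi.
Qed.

End ergodic_optimization.

(** * Homogeneous maps *)

Lemma compact_set_type {X : topologicalType} (A : set X) :
  compact A -> compact [set: set_type A].
Proof.
move=> cA F PF _; have FA : (set_val @ F) A.
  by apply: (@filterS _ F _ setT); [move=> x _; exact: set_mem (valP x)|exact: filterT].
have [x [Ax clx]] := cA (set_val @ F) (fmap_proper_filter _ PF) FA.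
exists (SigSub (mem_set Ax)); split => // B C FB.
rewrite nbhsE => -[_ [[V oV <-] Vx] VC].
have FVB : (set_val @ F) (set_val @` B) by apply: (@filterS _ F _ B) FB => y By; exists y.
have [_ [[y By <-] Vy]] := clx _ _ FVB (open_nbhs_nbhs (conj oV Vx)).
by exists y; split => //; exact: VC.
Qed.

Lemma continuous_set_type {Z X : topologicalType} (A : set X)
    (f : Z -> set_type A) :
  continuous (fun z => set_val (f z)) -> continuous f.
Proof. by move=> /continuousP cf; apply/continuousP => _ [V oV <-]; exact: cf. Qed.

Section euclidean_norm.
Context {R : realType} {d : nat}.
Implicit Types x : 'rV[R]_d.

Lemma enorm_ge0 x : 0 <= enorm x.
Proof. exact: sqrtr_ge0. Qed.

Lemma enorm0 : enorm (0 : 'rV[R]_d) = 0.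
Proof. by rewrite -(scale0r (0 : 'rV[R]_d)) enormZ normr0 mul0r. Qed.

Lemma enorm_gt0 x : x != 0 -> 0 < enorm x.
Proof.
move=> x0; rewrite lt_neqAle enorm_ge0 andbT eq_sym.
by apply: contra_neq x0; exact: enorm_eq0.
Qed.

Lemma enormZ_ge0 (a : R) x : 0 <= a -> enorm (a *: x) = a * enorm x.
Proof. by move=> a0; rewrite enormZ ger0_norm. Qed.

Lemma normr_le_enorm x : `|x| <= enorm x.
Proof.
rewrite [leLHS]/Num.norm/= mx_normrE; apply/bigmax_leP; split; first exact: enorm_ge0.
move=> [i j] _ /=; rewrite ord1 -sqrtr_sqr ler_wsqrtr// (bigD1 j)//= lerDl.
by apply: sumr_ge0 => k _; exact: sqr_ge0.
Qed.

Lemma continuous_enorm : continuous (@enorm R d).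
Proof.
move=> x; apply: (continuous_comp _ (@sqrt_continuous R _)).
apply: continuous_fun_sum => i; move=> {}x.
exact: (@continuous_comp _ _ _ (fun y : 'rV[R]_d => y 0 i) (fun r : R => r ^+ 2)
  x (@coord_continuous R 1 d _ i x) (@exprn_continuous R 2 _)).
Qed.

End euclidean_norm.

Lemma compact_sphere (R : realType) (n : nat) : compact [set: sphere R n].
Proof.
apply: compact_set_type; apply: bounded_closed_compact.
  exists 1; split; first exact: num_real.
  by move=> r r1 x /= x1; rewrite (le_trans (normr_le_enorm x))// x1 ltW.
rewrite (_ : usphere R n.+1 = @enorm R n.+1 @^-1` [set 1])//.
by apply: closed_comp; [move=> x _; exact: continuous_enorm|exact: closed_eq].
Qed.

Lemma enorm_sphere {R : realType} {n : nat} (z : sphere R n) :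
  enorm (sval z) = 1.
Proof. exact: set_mem (svalP z). Qed.

Lemma polar_decomposition {R : realType} {n : nat} (x : 'rV[R]_n.+1) :
  exists z : sphere R n, x = enorm x *: sval z.
Proof.
have [->|x0] := eqVneq x 0; first by exists point; rewrite enorm0 scale0r.
have x1 : (enorm x)^-1 *: x \in usphere R n.+1.
  rewrite inE /usphere/= enormZ_ge0 ?invr_ge0 ?enorm_ge0// mulVf//.
  by rewrite gt_eqF// enorm_gt0.
exists (exist (fun y => y \in usphere R n.+1) _ x1) => /=; rewrite scalerA divff ?scale1r//.
by rewrite gt_eqF// enorm_gt0.
Qed.

Section homogeneous_map.
Context {R : realType} {n : nat}.
Variable g : 'rV[R]_n.+1 -> 'rV[R]_n.+1.
Hypothesis cg : continuous g.
Hypothesis hg : linearly_homogeneous g.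
Hypothesis g_eq0 : forall x, g x = 0 -> x = 0.
Local Notation S := (sphere R n).
Local Notation G := (sphere_map g_eq0).

Let csval : continuous (fun z : S => sval z).
Proof. exact: initial_continuous. Qed.

Lemma iter_homogeneous k : linearly_homogeneous (iter k g).
Proof. by elim: k => [|k IH] a x a0 //=; rewrite IH// hg. Qed.

Lemma iter_enorm_gt0 k (z : S) : 0 < enorm (iter k g (sval z)).
Proof.
elim: k => [|k IH] /=; first by rewrite enorm_sphere.
apply: enorm_gt0; apply: contraTneq IH => /g_eq0 ->.
by rewrite enorm0 ltxx.
Qed.

Lemma growth_gt0 (z : S) : 0 < growth g z.
Proof. exact: (iter_enorm_gt0 1). Qed.

Lemma sphere_mapE (z : S) : g (sval z) = growth g z *: sval (G z).
Proof. by rewrite /= scalerA divff ?scale1r// gt_eqF// growth_gt0. Qed.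

Lemma continuous_ln_iter k :
  continuous (fun z : S => ln (enorm (iter k g (sval z)))).
Proof.
move=> z; apply: continuous_comp; last exact/continuous_ln/iter_enorm_gt0.
apply: continuous_comp; last exact: continuous_enorm.
elim: k => [|k IH] /=; first exact: csval.
by apply: (continuous_comp IH); exact: cg.
Qed.

Lemma continuous_sphere_map : continuous (G : S -> S).
Proof.
apply: continuous_set_type => z; rewrite set_valE/=.
have cgz : {for z, continuous (fun z : S => g (sval z))}.
  by apply: continuous_comp; [exact: csval|exact: cg].
have cD : {for z, continuous (fun z : S => growth g z)}.
  exact: (continuous_comp cgz (@continuous_enorm _ _ _)).
have cV : {for z, continuous (fun z : S => (growth g z)^-1)}.
  by apply: continuousV => //; rewrite gt_eqF// growth_gt0.
exact: (cvgZ cV cgz).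
Qed.

(** The function [|x| * exp (- h (x / |x|))] is a strict Lyapunov function: along
    [g] it decreases by the factor [exp (- e)]. *)
Lemma lyapunov_function_decay (h : S -> R) (e : R) :
  (forall z, ln (growth g z) + h z - h (G z) <= - e) ->
  forall k r z, 0 <= r -> exists r' z',
    [/\ 0 <= r', iter k g (r *: sval z) = r' *: sval z' &
        r' * expR (- h z') <= expR (- e) ^+ k * (r * expR (- h z))].
Proof.
move=> he k r z r0; elim: k => [|k [s [w [s0 gs sw]]]].
  by exists r, z; rewrite expr0 mul1r.
exists (s * growth g w), (G w); split.
- by rewrite mulr_ge0// ltW// growth_gt0.
- by rewrite iterS gs hg// sphere_mapE scalerA.
apply: (@le_trans _ _ (expR (- e) * (s * expR (- h w)))); last first.
  by rewrite exprS -mulrA ler_pM2l ?expR_gt0.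
rewrite mulrCA -mulrA ler_wpM2l// -expRD -[growth g w]lnK ?posrE ?growth_gt0//.
by rewrite -expRD ler_expR; have := he w; lra.
Qed.

Lemma exponentially_stable (h : S -> R) (e : R) : 0 < e -> continuous h ->
  (forall z, ln (growth g z) + h z - h (G z) <= - e) ->
  exists2 K, 0 < K &
    forall k x, enorm (iter k g x) <= K * expR (- e) ^+ k * enorm x.
Proof.
move=> e0 ch he; have [M hM] := compact_continuous_bounded (@compact_sphere R n) ch.
exists (expR (2 * M)); first exact: expR_gt0.
move=> k x; have [z xz] := polar_decomposition x.
have [r [w [r0 gx rw]]] := lyapunov_function_decay he k z (enorm_ge0 x).
rewrite {1}xz gx enormZ_ge0// enorm_sphere mulr1.
apply: (@le_trans _ _ (expR (- e) ^+ k * enorm x * expR (h w - h z))).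
  have -> : expR (- e) ^+ k * enorm x * expR (h w - h z) =
      expR (- e) ^+ k * (enorm x * expR (- h z)) * expR (h w).
    by rewrite expRD; ring.
  by rewrite -ler_pdivrMr ?expR_gt0// -expRN.
rewrite -[leRHS]mulrA [leRHS]mulrC ler_wpM2l ?mulr_ge0 ?exprn_ge0 ?expR_ge0 ?enorm_ge0//.
rewrite ler_expR.
by have /ler_normlP[] := hM z; have /ler_normlP[] := hM w; lra.
Qed.

Lemma exponentially_stable_asymptotically (K rho : R) : 0 < K -> 0 <= rho < 1 ->
  (forall k x, enorm (iter k g x) <= K * rho ^+ k * enorm x) ->
  asymptotically_stable g.
Proof.
move=> K0 /andP[rho0 rho1] gK; split.
  move=> e e0; exists (e / K); first by rewrite divr_gt0.
  move=> x; rewrite /eball/= ltr_pdivlMr// => xe k; apply: le_lt_trans xe.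
  rewrite (le_trans (gK k x))// mulrC ler_wpM2l ?enorm_ge0//.
  by rewrite ler_piMr ?(ltW K0)// exprn_ile1// ltW.
exists 1 => // x _; apply: norm_cvg0.
apply: (@squeeze_cvgr _ _ _ _ (cst 0) (fun k => K * enorm x * rho ^+ k)).
- apply: nearW => k; rewrite normr_ge0/= (le_trans (normr_le_enorm _))//.
  by rewrite (le_trans (gK k x))// mulrAC.
- exact: cvg_cst.
rewrite -[X in _ --> X](mulr0 (K * enorm x)); apply: cvgMl_tmp.
by apply: cvg_expr; rewrite ger0_norm.
Qed.

(** If no [h] made [ln |g z| + h z - h (G z)] negative for all [z], the ergodic
    maximizing measure would have a nonnegative exponent. For such an [h] the
    negativity is uniform by compactness, and the decay is exponential. *)
Lemma asymptotically_stable_of_ergodic :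
  (forall mu : probability S R,
     invariant_measure G mu -> ergodic_measure G mu ->
     lyapunov_exponent g mu < 0) ->
  asymptotically_stable g.
Proof.
move=> neg; have cphi : continuous (fun z : S => ln (growth g z)).
  exact: (@continuous_ln_iter 1).
have cG := continuous_sphere_map.
have [h [ch hlt]] : exists h : S -> R, continuous h /\
    forall z, ln (growth g z) + h z - h (G z) < 0.
  apply: contrapT => /forallNP noh.
  have [|mu [inv erg]] := ergodic_maximizing_measure (@compact_sphere R n) cG cphi.
    move=> h ch; apply: contrapT => /forallNP hlt; apply: (noh h); split => // z.
    by rewrite ltNge; apply/negP; exact: hlt.
  by rewrite leNgt => /negP; apply; exact: neg mu inv erg.
have cq : continuous (fun z : S => ln (growth g z) + h z - h (G z)).
  exact: continuous_add_coboundary.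
have S0 : [set: S] !=set0 by exists point.
have [w _ wmax] := compact_EVT_max S0 (@compact_sphere R n)
  (continuous_subspaceT cq).
pose e := - (ln (growth g w) + h w - h (G w)).
have e0 : 0 < e by rewrite oppr_gt0.
have he : forall z, ln (growth g z) + h z - h (G z) <= - e.
  by move=> z; rewrite opprK; apply: wmax; rewrite inE.
have [K K0 gK] := exponentially_stable e0 ch he.
apply: (exponentially_stable_asymptotically K0 _ gK).
by rewrite expR_ge0 expR_lt1 oppr_lt0.
Qed.

(** The integral of [ln |g^k z|] is [k] times the exponent, but stability bounds
    [|g^k z|] independently of [k] and [z]. *)
Lemma lyapunov_exponent_le0 (mu : probability S R) :
  lyapunov_stable g -> invariant_measure G mu -> lyapunov_exponent g mu <= 0.
Proof.
move=> /(_ 1 ltr01)[dl dl0 stab] inv; set lam := lyapunov_exponent g mu.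
pose l k (z : S) := ln (enorm (iter k g (sval z))).
have cl k : continuous (l k) by exact: continuous_ln_iter.
have cG := continuous_sphere_map.
have int (f : S -> R) : continuous f -> mu.-integrable setT (EFin \o f).
  by move=> cf; exact: (continuous_integrable (@compact_sphere R n) mu measurableT cf).
have lS k z : l k.+1 z = l 1%N z + l k (G z).
  rewrite /l -lnM ?posrE ?iter_enorm_gt0//; congr ln.
  rewrite iterSr sphere_mapE iter_homogeneous ?ltW ?growth_gt0//.
  by rewrite enormZ_ge0// ltW// growth_gt0.
have intl k : \int[mu]_z l k z = lam *+ k.
  elim: k => [|k IH].
    rewrite (@eq_Rintegral _ _ _ mu _ (cst 0)) ?Rintegral_cst ?mul0r//.
    by move=> z _; rewrite /l /= enorm_sphere ln1.
  have clG : continuous (fun z => l k (G z)).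
    exact: (continuous_compose cG (cl k)).
  rewrite (@eq_Rintegral _ _ _ mu _ (fun z => l 1%N z + l k (G z))); last first.
    by move=> z _; exact: lS.
  rewrite RintegralD//; [|exact: int..].
  rewrite (@invariant_Rintegral _ _ _ mu G setT (l k))//; last 3 first.
  - exact: (@continuous_self_measurable_borel _ S G cG).
  - exact: (@continuous_measurable_borel _ S (l k) (cl k)).
  - exact: int.
  by rewrite IH mulrS.
have l_le k z : l k z <= ln (2 / dl).
  rewrite ler_ln ?posrE ?iter_enorm_gt0 ?divr_gt0//.
  have : eball 1 (iter k g ((dl / 2) *: sval z)).
    apply: stab; rewrite /eball/= enormZ_ge0 ?enorm_sphere; lra.
  rewrite /eball/= iter_homogeneous ?enormZ_ge0; [|lra..].
  by rewrite -ltr_pdivlMl ?divr_gt0// mulr1 invf_div => /ltW.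
have lam_le k : lam *+ k <= ln (2 / dl).
  have -> : ln (2 / dl) = \int[mu]_(_ in setT) ln (2 / dl).
    by rewrite Rintegral_cst//= probability_setT/= mulr1.
  rewrite -intl; apply: le_Rintegral => //.
  - exact: int.
  - exact: (int (cst _) (@cst_continuous _ _ _)).
rewrite leNgt; apply/negP => lam0.
have := lam_le (Num.truncn (ln (2 / dl) / lam)).+1.
rewrite leNgt => /negP; apply; rewrite -[lam *+ _]mulr_natl -ltr_pdivrMr//.
exact: truncnS_gt.
Qed.

End homogeneous_map.

Theorem theorem4p2 (R : realType) (n : nat) (dim_ge2 : (2 <= n.+1)%N)
    (g : 'rV[R]_n.+1 -> 'rV[R]_n.+1)
    (g_cont : continuous g)
    (g_hom : linearly_homogeneous g)
    (g_eq0 : forall x, g x = 0 -> x = 0) :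
  let G := sphere_map g_eq0 in
  ((forall mu : probability (sphere R n) R,
      invariant_measure G mu -> ergodic_measure G mu ->
      lyapunov_exponent g mu < 0) ->
    asymptotically_stable g)
  /\
  (lyapunov_stable g ->
    forall mu : probability (sphere R n) R,
      invariant_measure G mu -> ergodic_measure G mu ->
      lyapunov_exponent g mu <= 0).
Proof.
split; first exact: asymptotically_stable_of_ergodic.
by move=> stab mu inv _; exact: lyapunov_exponent_le0 stab inv.
Qed.
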